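(* Let $M$ be a matroid on a ground set $S$, and let $A$ be a matroidal Latin square of degree $n$ over $M$. Then $A$ contains an independent partial transversal of size $\lceil 2n/3\rceil$.
   Context: A matroidal Latin square (MLS) of degree $n$ over a matroid $M$ with ground set $S$ is an $n\times n$ matrix $A$ whose entries are elements of $S$, where each row and each column of $A$ is a base of $M$ (so the $n$ entries of any single row or column are distinct, and $M$ has rank $n$; the same element of $S$ may occur in several cells of $A$ that lie in different rows and columns). An independent partial transversal of $A$ is an independent subset of entries of $A$, no two of which lie in the same row or column of $A$; its size is the number of its elements. That is, an independent partial transversal of size $k$ is given by $k$ cells, no two in the same row or column, whose entries are $k$ distinct elements of $S$ forming an independent set of $M$.
   Formalization: The degree n = 2 is excluded, because the claim fails there: the Latin square with rows (0,1) and (1,0) over the free matroid on {0,1} has no independent partial transversal of size 2. *)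

(* Defs.v *)
From mathcomp Require Import all_boot all_order all_algebra.

Set Implicit Arguments.
Unset Strict Implicit.
Unset Printing Implicit Defensive.

Record matroid (S : finType) := Matroid {
  indep : pred {set S};
  indep_set0 : indep set0;
  indep_sub : forall I J : {set S}, I \subset J -> indep J -> indep I;
  indep_augment : forall I J : {set S}, indep I -> indep J -> #|I| < #|J| ->
    exists2 x, x \in J :\: I & indep (x |: I)
}.

Definition base (S : finType) (M : matroid S) (B : {set S}) : bool :=
  maxset (indep M) B.

(* Injectivity is required because the image set alone would forget repeated  *)
(* entries within a row or column.                                            *)
Definition base_family (S : finType) (M : matroid S) (n : nat) (f : 'I_n -> S)
  : Prop := injective f /\ base M [set f i | i : 'I_n].

Definition matroidal_latin_square (S : finType) (M : matroid S) (n : nat)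
    (A : 'M[S]_n) : Prop :=
  (forall i, base_family M (fun j => A i j)) /\
  (forall j, base_family M (fun i => A i j)).

(* A transversal is a set of cells, so that the choice of cell is recorded    *)
(* even when an element of S occurs in several cells of A.                    *)
Definition independent_partial_transversal (S : finType) (M : matroid S)
    (n : nat) (A : 'M[S]_n) (C : {set 'I_n * 'I_n}) : Prop :=
  [/\ {in C &, injective (fun c : 'I_n * 'I_n => c.1)},
      {in C &, injective (fun c : 'I_n * 'I_n => c.2)},
      {in C &, injective (fun c : 'I_n * 'I_n => A c.1 c.2)}
    & indep M [set A c.1 c.2 | c in C]].

Definition free_matroid (S : finType) : matroid S.
Proof.
apply: (@Matroid S predT) => // I J _ _ ltIJ.
have /subsetPn[x xJ xI] : ~~ (J \subset I).
  by apply: contraL ltIJ => /subset_leq_card; rewrite -leqNgt.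
by exists x; rewrite // inE xI.
Defined.

(* The bound 2n/3 rounded up is not attained in degree 2: for the Latin       *)
(* square (0 1; 1 0) over the free matroid on two elements, both diagonals    *)
(* are constant, while the bound would be 2. Hence the exclusion of n = 2.    *)
Lemma degree2_counterexample :
  exists A : 'M['I_2]_2, matroidal_latin_square (free_matroid 'I_2) A /\
  forall C, independent_partial_transversal (free_matroid 'I_2) A C -> #|C| < 2.
Proof.
exists (\matrix_(i, j) (i + j))%R; split.
  have bij_base (f : 'I_2 -> 'I_2) : injective f ->
      base_family (free_matroid 'I_2) f.
    move=> injf; split=> //; apply/maxsetP; split=> // B _ sB.
    apply/eqP; rewrite eqEsubset sB andbT.
    have -> : [set f i | i : 'I_2] = setT.
      by apply/eqP; rewrite eqEcard subsetT cardsT card_imset /= ?leqnn.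
    exact: subsetT.
  split=> i; apply: bij_base => j k; rewrite !mxE.
    exact: GRing.addrI.
  exact: GRing.addIr.
move=> C [inj1 inj2 inj3 _]; rewrite ltnNge; apply/negP => /card_gt1P[c [d [cC dC cd]]].
have ne1 : c.1 != d.1 by apply: contra_neq cd => /inj1; apply.
have ne2 : c.2 != d.2 by apply: contra_neq cd => /inj2; apply.
case/eqP: cd; apply: inj3 => //; rewrite !mxE.
case: c d ne1 ne2 {cC dC} => [[[|[|?]] ?] [[|[|?]] ?]] [[[|[|?]] ?] [[|[|?]] ?]] //= _ _;
by apply: val_inj.
Qed.

(* Main.v *)
(* Let C be a maximum independent partial transversal, with entry set T of    *)
(* size k, and let r = n - k.  By maximality every cell whose row and column  *)
(* both avoid C has its entry in the span of T.  Suppose r >= 2 and pick rows *)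
(* i <> i' avoiding C.  The r independent entries of row i in the columns     *)
(* avoiding C lie in the span of a set L of at least r elements of T, each of *)
(* which can be exchanged for one of these entries.  After such an exchange   *)
(* the column of the discarded element is free, and the span is unchanged, so *)
(* by maximality row i' has its entry in that column in the span of T.  Thus  *)
(* row i' has at least 2 r independent entries in the span of T, and          *)
(* 2 r <= k, that is, 2 n <= 3 k.  If r <= 1, then 2 n <= 3 k unless n is 1   *)
(* or 2, and for n = 1 the free part of row i alone gives r <= k.             *)
Require Import Defs.
From mathcomp Require Import all_boot all_order all_algebra.
From mathcomp Require Import zify.
Import Order.TTheory GRing.Theory Num.Theory.
Local Open Scope ring_scope.

Set Implicit Arguments.
Unset Strict Implicit.
Unset Printing Implicit Defensive.

(** Every count rests on [card_spanned]. In the case of two free rows, [spanned_exchangeable] yields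
    the discardable elements of T, [spanned_exchange] shows that the span survives an exchange, and
    [max_ipt_exchange] that maximality does; [max_ipt_two_thirds] combines them. *)

Section Span.
Local Open Scope nat_scope.
Variables (S : finType) (M : matroid S).
Implicit Types (I J K T : {set S}) (d t x : S).

(* This is the matroid closure only when I is independent. *)
Definition spanned I x := (x \in I) || ~~ indep M (x |: I).

Lemma card_spanned I K : indep M I -> indep M K ->
  {in K, forall x, spanned I x} -> #|K| <= #|I|.
Proof.
move=> indI indK spK; rewrite leqNgt; apply/negP => /(indep_augment indI indK).
by case=> x /setDP[xK xI]; have:= spK x xK; rewrite /spanned (negPf xI) => /negPf->.
Qed.

Lemma indep_extend I J : indep M I -> indep M J ->
  exists B : {set S},
    [/\ I \subset B, B \subset I :|: J, indep M B & #|J| <= #|B|].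
Proof.
move=> indI indJ; have [m] := ubnP (#|J| - #|I|).
elim: m I indI => // m IHm I indI ltm.
have [leJI | ltIJ] := leqP #|J| #|I|; first by exists I; rewrite subxx subsetUl.
have [x /setDP[xJ xI] indxI] := indep_augment indI indJ ltIJ.
have [|B [sB sBU indB cB]] := IHm _ indxI; first by rewrite cardsU1 xI; lia.
exists B; split=> //; first exact: subset_trans (subsetUr _ _) sB.
apply: subset_trans sBU _; rewrite -setUA subUset sub1set subxx andbT.
by rewrite inE xJ orbT.
Qed.

(** The first conjunct makes the exchange preserve the size of [T] when [t] is in [T]. For [d]
    outside an independent [T] but in its span, the exchangeable [t] in [T] complete [d] to its
    fundamental circuit. *)
Definition exchangeable T d t := (d \notin T :\ t) && indep M (d |: T :\ t).

(** If [d |: L] were independent, it would extend within [d |: T] to an independent set at least as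
    large as [T]. This set omits a single [t] of [T], which is then exchangeable and so in [L], a
    contradiction. *)
Lemma spanned_exchangeable T d (L : {set S}) : indep M T -> spanned T d ->
  L \subset T -> {in T, forall t, exchangeable T d t -> t \in L} ->
  spanned L d.
Proof.
move=> indT spd sLT exL; rewrite /spanned.
have [dT | dT] := boolP (d \in T).
  by rewrite exL // /exchangeable !inE eqxx setD1K.
move: spd; rewrite /spanned (negPf dT) /= => ndT.
apply/orP; right; apply/negP => indL.
have [B [sB sBT indB cB]] := indep_extend indL indT.
have {}sBT : B \subset d |: T.
  by apply: subset_trans sBT _; rewrite -setUA (setUidPr sLT).
have /subsetPn[t tT tB] : ~~ (d |: T \subset B).
  by apply: contra ndT => /indep_sub; apply.
have td : t != d by apply: contraNneq tB => ->; rewrite (subsetP sB) ?setU11.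
move: tT; rewrite in_setU1 (negPf td) /= => tT.
have dTt : d \notin T :\ t by rewrite inE (negPf dT) andbF.
have defB : B = d |: T :\ t.
  apply/eqP; rewrite eqEcard cardsU1 dTt add1n.
  apply/andP; split; last by move: cB; rewrite (cardsD1 t T) tT.
  apply/subsetP => y yB; have:= subsetP sBT y yB; rewrite !inE.
  by case: (eqVneq y d) => //= _ ->; rewrite andbT; apply: contraNneq tB => <-.
case/negP: tB; apply/(subsetP sB)/setU1r/exL => //.
by rewrite /exchangeable dTt -defB.
Qed.

(** If [x] lay outside the span of [T], then [x |: T] would augment the exchanged set by [x] or by
    [t]. The former contradicts the assumption on [x]; the latter makes [d |: T] independent. *)
Lemma spanned_exchange T d t x : indep M T -> spanned T d -> t \in T ->
  exchangeable T d t -> spanned (d |: T :\ t) x -> spanned T x.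
Proof.
move=> indT spd tT /andP[dTt indT'].
have [-> | dt] := eqVneq d t; first by rewrite setD1K.
have dT : d \notin T by move: dTt; rewrite !inE dt.
move: spd; rewrite /spanned (negPf dT) /= => ndT spx.
have [//|xT] := boolP (x \in T); apply/negP => indx.
have := indep_augment indT' indx.
rewrite !cardsU1 dTt xT (cardsD1 t T) tT ltnS => /(_ (leqnn _)) [y].
move=> /setDP[yxT yT'] indy.
have [yx | yx] := eqVneq y x.
  by move: spx; rewrite -yx (negPf yT') indy.
move: yxT yT'; rewrite !inE (negPf yx) /= => yT.
rewrite yT andbT negb_or negbK => /andP[_ /eqP yt].
by case/negP: ndT; move: indy; rewrite yt setUCA setD1K.
Qed.

End Span.

Lemma imsetD1_inj (T U : finType) (f : T -> U) (C : {set T}) (q : T) :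
  q \in C -> {in C &, injective f} -> f @: (C :\ q) = f @: C :\ f q.
Proof.
move=> qC injf; apply/setP=> y; rewrite in_setD1.
apply/imsetP/andP=> [[z /setD1P[zq zC] ->] | [yq /imsetP[z zC yz]]].
  split; last exact: imset_f.
  by apply: contra_neq zq; apply: injf.
by exists z => //; rewrite in_setD1 zC andbT; apply: contraNneq yq => <-; apply/eqP.
Qed.

Lemma imset_injU1 (T U : finType) (f : T -> U) (C : {set T}) (p : T) :
  {in C &, injective f} -> f p \notin f @: C -> {in p |: C &, injective f}.
Proof.
move=> injf fp; apply/imset_injP.
have pC : p \notin C by apply: contra fp; apply: imset_f.
by rewrite imsetU1 !cardsU1 fp pC (card_in_imset injf).
Qed.

Section Transversal.
Local Open Scope nat_scope.
Variables (S : finType) (M : matroid S) (n : nat) (A : 'M[S]_n).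
Implicit Types (C D : {set 'I_n * 'I_n}) (p q : 'I_n * 'I_n).

Notation ipt := (independent_partial_transversal M A).
Notation entry := (fun c : 'I_n * 'I_n => A c.1 c.2).
Notation rows C := [set c.1 | c in C : {set 'I_n * 'I_n}].
Notation cols C := [set c.2 | c in C : {set 'I_n * 'I_n}].
Notation entries C := [set A c.1 c.2 | c in C : {set 'I_n * 'I_n}].

(** Boolean form, with injectivity read off from cardinals, so that a maximum can be chosen. *)
Definition iptb C := [&& #|rows C| == #|C|, #|cols C| == #|C|,
  #|entries C| == #|C| & indep M (entries C)].

Lemma iptP C : reflect (ipt C) (iptb C).
Proof.
apply: (iffP and4P) => -[].
  by move=> /imset_injP ? /imset_injP ? /imset_injP ? ?; split.
by move=> ? ? ? ?; split=> //; apply/imset_injP.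
Qed.

Lemma ipt_sub C D : D \subset C -> ipt C -> ipt D.
Proof.
move=> /subsetP sDC [inj1 inj2 inj3 indC]; split.
- exact: sub_in2 inj1.
- exact: sub_in2 inj2.
- exact: sub_in2 inj3.
- by apply: indep_sub indC; apply/imsetS/subsetP.
Qed.

Lemma ipt_add C p : ipt C -> p.1 \notin rows C -> p.2 \notin cols C ->
  entry p \notin entries C -> indep M (entry p |: entries C) -> ipt (p |: C).
Proof.
move=> [inj1 inj2 inj3 indC] p1 p2 pe indp.
by split; [exact: imset_injU1 .. | rewrite imsetU1].
Qed.

Definition max_ipt C := ipt C /\ forall D, ipt D -> #|D| <= #|C|.

Lemma max_ipt_ex : exists C, max_ipt C.
Proof.
have ipt0 : iptb set0 by rewrite /iptb !imset0 !cards0 indep_set0.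
case: (@arg_maxnP _ set0 iptb (fun C => #|C|) ipt0) => C /iptP iptC maxC.
by exists C; split=> // D /iptP /maxC.
Qed.

Lemma max_ipt_spanned C p : max_ipt C -> p.1 \notin rows C ->
  p.2 \notin cols C -> spanned M (entries C) (entry p).
Proof.
move=> [iptC maxC] p1 p2; rewrite /spanned; apply/norP => -[pe].
rewrite negbK => indp; have /maxC := ipt_add iptC p1 p2 pe indp.
by rewrite cardsU1 (contra _ p1) ?add1n ?ltnn //; apply: (imset_f fst).
Qed.

(** The size is unchanged, so maximality persists; the gain is that the column of [q] becomes
    free. *)
Lemma max_ipt_exchange C p q : max_ipt C -> q \in C ->
  p.1 \notin rows C -> p.2 \notin cols C ->
  exchangeable M (entries C) (entry p) (entry q) -> max_ipt (p |: C :\ q).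
Proof.
move=> [iptC maxC] qC p1 p2 /andP[pe indp].
have sC := subD1set C q.
have pC : p \notin C :\ q.
  by apply: contra p1 => /(subsetP sC); apply: (imset_f fst).
split; last by rewrite cardsU1 pC -[1 + _]/((true : nat) + _) -{1}qC -cardsD1.
have defE : entries (C :\ q) = entries C :\ entry q.
  by apply: (imsetD1_inj (f := entry)) => //; case: iptC.
apply: ipt_add; rewrite ?defE //; first exact: ipt_sub iptC.
  by apply: contra p1; apply/subsetP/imsetS.
by apply: contra p2; apply/subsetP/imsetS.
Qed.

Hypothesis rowsA : forall i, base_family M (fun j => A i j).

Lemma indep_row i (J : {set 'I_n}) : indep M [set A i j | j in J].
Proof.
have [_ /maxsetp] := rowsA i.
by apply: indep_sub; apply: imsetS; apply/subsetP.
Qed.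

Lemma card_row i (J : {set 'I_n}) : #|[set A i j | j in J]| = #|J|.
Proof. by have [inj_row _] := rowsA i; apply: card_imset. Qed.

Lemma card_entries C : ipt C -> #|entries C| = #|C|.
Proof. by case=> _ _ inj3 _; apply: card_in_imset. Qed.

(** The free part of one free row is spanned by the entries of [C]. This rules out an empty maximum
    when [n] is 1. *)
Lemma max_ipt_half C : max_ipt C -> #|C| < n -> n <= 2 * #|C|.
Proof.
move=> maxC ltCn; have [[inj1 inj2 _ indC] _] := maxC.
have /card_gt0P[i iC] : 0 < #|~: rows C|.
  by have := cardsC (rows C); rewrite card_ord (card_in_imset inj1); lia.
have := cardsC (cols C); rewrite card_ord (card_in_imset inj2).
have : #|~: cols C| <= #|C|.
  rewrite -(card_row i) -(card_entries maxC.1).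
  apply: card_spanned (indep_row _ _) _ => // _ /imsetP[c cC ->].
  by apply: (max_ipt_spanned (p := (i, c))) => //; rewrite -in_setC.
by lia.
Qed.

Lemma max_ipt_two_thirds C : max_ipt C -> #|C|.+1 < n -> 2 * n <= 3 * #|C|.
Proof.
move=> maxC ltCn; have [[inj1 inj2 inj3 indC] _] := maxC.
have /card_gt1P[i [i' [iC i'C ii']]] : 1 < #|~: rows C|.
  by have := cardsC (rows C); rewrite card_ord (card_in_imset inj1); lia.
rewrite !in_setC in iC i'C.
pose U := ~: cols C.
pose L := [set q in C |
  [exists c in U, exchangeable M (entries C) (A i c) (entry q)]].
have sLC : L \subset C by apply/subsetP=> q /setIdP[].
have spU a c : a \notin rows C -> c \in U -> spanned M (entries C) (A a c).
  by move=> aC cU; apply: (max_ipt_spanned (p := (a, c))) => //; rewrite -in_setC.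
have leUL : #|U| <= #|L|.
  rewrite -(card_row i) -(card_entries (ipt_sub sLC maxC.1)).
  have sLE : entries L \subset entries C by apply: imsetS.
  apply: card_spanned (indep_row _ _) _; first exact: indep_sub indC.
  move=> _ /imsetP[c cU ->].
  apply: (spanned_exchangeable indC) => //; first exact: spU.
  move=> _ /imsetP[q qC ->] exq; apply/imsetP; exists q => //.
  by rewrite inE qC; apply/exists_inP; exists c.
have leULC : #|cols L :|: U| <= #|C|.
  rewrite -(card_row i') -(card_entries maxC.1).
  apply: card_spanned (indep_row _ _) _ => // _ /imsetP[j jLU ->].
  case/setUP: jLU => [/imsetP[q /setIdP[qC /exists_inP[c cU exq]] ->] | jU];
    last exact: spU.
  rewrite in_setC in cU.
  have eqE : entries ((i, c) |: C :\ q) = A i c |: entries C :\ entry q.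
    by rewrite imsetU1 (imsetD1_inj (f := entry)).
  apply: (spanned_exchange (d := A i c) (t := entry q)) => //.
  - by apply: spU; rewrite ?in_setC.
  - exact: (imset_f entry).
  (* Once [q] is exchanged for [(i, c)], both row [i'] and the column of [q] are free. *)
  rewrite -eqE; apply: (max_ipt_spanned (p := (i', q.2))).
  - exact: max_ipt_exchange.
  - rewrite imsetU1 in_setU1 /= negb_or eq_sym ii' /=.
    by apply: contra i'C; apply/subsetP/imsetS/subD1set.
  rewrite imsetU1 (imsetD1_inj (f := snd)) // !inE eqxx orbF /=.
  by apply: contraNneq cU => <-; apply: (imset_f snd).
have disjLU : [disjoint cols L & U].
  by rewrite disjoints_subset setCK imsetS.
have := leq_card_setU (cols L) U; rewrite disjLU => -[_ /eqP cLU].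
have cL : #|cols L| = #|L|.
  by apply: card_in_imset; apply: sub_in2 inj2; apply/subsetP.
(* With [u = n - #|C|] free columns, [u <= #|L|] and [#|L| + u <= #|C|] give [2 * u <= #|C|]. *)
have := cardsC (cols C); rewrite card_ord (card_in_imset inj2) -/U.
by lia.
Qed.

End Transversal.

Lemma ceil_two_thirds n :
  Num.ceil (2 * n%:R / 3 : rat) = ((2 * n + 2) %/ 3)%N%:Z.
Proof.
set m := (_ %/ _)%N; have m_le : (3 * m <= 2 * n + 2)%N by lia.
have m_ge : (2 * n <= 3 * m)%N by lia.
apply/ceil_def/andP; split.
  rewrite ltr_pdivlMr // intrB mulrBl ltrBlDr mul1r -!pmulrn -!natrM -natrD ltr_nat.
  by lia.
by rewrite ler_pdivrMr // -pmulrn -!natrM ler_nat mulnC; lia.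
Qed.

Theorem theorem2p2 (S : finType) (M : matroid S) (n : nat) (A : 'M[S]_n)
    (n_neq2 : n <> 2%N) :
  matroidal_latin_square M A ->
  exists C : {set 'I_n * 'I_n},
    independent_partial_transversal M A C /\
    #|C|%:Z = Num.ceil (2 * n%:R / 3 : rat).
Proof.
move=> [rowsA _]; have [C maxC] := max_ipt_ex M A.
have le23 : (2 * n <= 3 * #|C|)%N.
  have := max_ipt_two_thirds rowsA maxC; have := max_ipt_half rowsA maxC.
  by lia.
(* A maximum transversal may exceed the required size, so it is trimmed. *)
have /card_geqP[s [uniq_s size_s sC]] : ((2 * n + 2) %/ 3 <= #|C|)%N by lia.
exists [set c in s]; split.
  by apply: ipt_sub maxC.1; apply/subsetP=> c; rewrite inE => /sC.
by rewrite ceil_two_thirds cardsE (card_uniqP uniq_s) size_s.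
Qed.
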